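(* The set $C_{K_8}$ of all $8$-satisfactory colorings of $K_8$ has cardinality $\mathfrak c=|\mathbb R|$.
   Context: $K_8$ is the set of positive integers whose prime factors all lie in $\{2,3,5,7\}$. An $8$-satisfactory coloring of $K_8$ is a map $c:K_8\to\{1,\dots,8\}$ with $c(i)=i$ for $1\le i\le 8$ and such that for every $a\in K_8$ the colors $c(a),c(2a),\dots,c(8a)$ are all different. *)

(* Defs.v *)
From mathcomp Require Import all_boot all_order all_algebra.
From mathcomp Require Import all_classical all_reals.

Set Implicit Arguments.
Unset Strict Implicit.
Unset Printing Implicit Defensive.

Local Open Scope nat_scope.
Local Open Scope classical_set_scope.

Definition primes8 : nat_pred := [pred p | p \in [:: 2; 3; 5; 7]].

(* [pi.-nat m] includes the condition [0 < m]. *)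
Definition K8 : Type := {m : nat | primes8.-nat m}.

(* The set {1, ..., 8}, used both for the colors and for the multipliers. *)
Definition color8 : Type := {i : nat | 0 < i <= 8}.

Lemma color8_in_K8 (i : color8) : primes8.-nat (val i).
Proof. by case: i => -[|[|[|[|[|[|[|[|[|i]]]]]]]]]. Qed.

Definition K8_of_color (i : color8) : K8 := exist _ (val i) (color8_in_K8 i).

Lemma K8_mul_subproof (x y : K8) : primes8.-nat (val x * val y).
Proof. by rewrite pnatM (valP x) (valP y). Qed.

Definition K8_mul (x y : K8) : K8 :=
  exist _ (val x * val y) (K8_mul_subproof x y).

Definition satisfactory8 (c : K8 -> color8) : Prop :=
  (forall i : color8, c (K8_of_color i) = i) /\
  (forall a : K8, injective (fun i : color8 => c (K8_mul (K8_of_color i) a))).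

Definition C_K8 : set (K8 -> color8) := [set c | satisfactory8 c].

(* Main.v *)
Require Import Defs.
From mathcomp Require Import all_boot all_order all_algebra.
From mathcomp Require Import all_classical all_reals.
From mathcomp Require Import lra zify.

Local Open Scope classical_set_scope.
Local Open Scope card_scope.

(** Let the level of [m] be its number of prime factors in {3, 5, 7}, counted
    with multiplicity.  Multiplication by 1, 2, 4, 8 preserves the level, while
    multiplication by 3, 5, 6, 7 raises it by one.  Put
    j(m) = v2(m) + 2 v5(m) + 3 v7(m) mod 4.  Multiplication by 1, 2, 4, 8 adds
    0, 1, 2, 3 to j, and so does multiplication by 3, 6, 5, 7.  Hence, if the
    color of [m] is the j(m)-th entry of a list of four colors attached to its
    level, the colors of a, 2a, ..., 8a exhaust the list of the level of a and
    the list of the next one.  The coloring is therefore satisfactory as soon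
    as even levels use the four colors 1, 2, 4, 8 and odd levels use 3, 5, 6, 7,
    in whatever order on each level.  The conditions c(i) = i only fix the order
    on levels 0 and 1, so every binary sequence [x] yields a coloring, in which
    [x n] decides whether two entries are exchanged on level n + 2
    ([coloring_of_bits_sat], [coloring_of_bits_inj]).

    Conversely, as K8 and the set of colors are countable, a coloring is encoded
    by the binary sequence that describes its graph.  So there are as many
    colorings as binary sequences, and as many binary sequences as real numbers
    ([bits_card_real]): reals embed into binary sequences by Dedekind cuts, and
    binary sequences into reals as base 3 expansions with digits 0 and 1. *)

(** * Comparison of cardinals by injections *)

Lemma card_le_of_inj {T U : Type} (A : set T) (B : set U) (f : T -> U) :
  {in A &, injective f} -> (forall x, A x -> B (f x)) -> A #<= B.
Proof.
move=> f_inj fAB; have := inj_card_eq f_inj.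
rewrite card_eq_le => /andP[_ leAfA]; apply: (card_le_trans leAfA).
by apply: subset_card_le => _ [x Ax <-]; apply: fAB.
Qed.

(** * The continuum as the cardinal of binary sequences *)

Section BitsAndReals.
Import Order.TTheory GRing.Theory Num.Theory.
Local Open Scope ring_scope.

Variable R : realType.
Implicit Types x y : nat -> bool.

Definition cut_bits (r : R) (n : nat) : bool :=
  if unpickle n is Some q then (ratr q : R) < r else false.

Lemma cut_bits_inj : injective cut_bits.
Proof.
suff neq_lt (r s : R) : r < s -> cut_bits r <> cut_bits s.
  by move=> r s Ers; case: (ltgtP r s) => // /neq_lt; rewrite Ers.
move=> /rat_in_itvoo[q]; rewrite in_itv /= => /andP[ltrq ltqs].
move=> /(congr1 (fun b => b (pickle q))).
by rewrite /cut_bits pickleK ltqs ltNge (ltW ltrq).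
Qed.

Definition ternary_sum x (n : nat) : R := \sum_(i < n) (x i)%:R * 3^-1 ^+ i.

Definition real_of_bits x : R := sup (range (ternary_sum x)).

Let pow3_gt0 n : 0 < (3^-1 : R) ^+ n.
Proof. by rewrite exprn_gt0 // invr_gt0. Qed.

Lemma ternary_sumS x n :
  ternary_sum x n.+1 = ternary_sum x n + (x n)%:R * 3^-1 ^+ n.
Proof. by rewrite /ternary_sum big_ord_recr. Qed.

Lemma ternary_sum_le x m n : (m <= n)%N -> ternary_sum x m <= ternary_sum x n.
Proof.
move=> /subnK <-; elim: (n - m)%N => [|k IHk]; first by rewrite add0n.
by rewrite addSn ternary_sumS (le_trans IHk) // lerDl mulr_ge0 // ltW.
Qed.

(** The right-hand side adds to the partial sum the whole tail with digits 1,
    whose value is the geometric sum of 3 ^- i over i >= m, that is,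
    3 / 2 * 3 ^- m. *)
Lemma ternary_sum_tail x m n :
  ternary_sum x n <= ternary_sum x m + 3 / 2 * 3^-1 ^+ m.
Proof.
have [lenm|/ltnW lemn] := leqP n m.
  by have := ternary_sum_le x n m lenm; have := pow3_gt0 m; lra.
(* Keeping the tail after n on the left makes the induction go through. *)
suff: ternary_sum x n + 3 / 2 * 3^-1 ^+ n <=
      ternary_sum x m + 3 / 2 * 3^-1 ^+ m by have := pow3_gt0 n; lra.
rewrite -(subnK lemn); elim: (n - m)%N => [|k IHk]; first by rewrite add0n.
rewrite addSn ternary_sumS exprS; have := pow3_gt0 (k + m).
by case: (x _) => /=; lra.
Qed.

Lemma ternary_sum_le_real x n : ternary_sum x n <= real_of_bits x.
Proof.
apply: ub_le_sup; last by exists n.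
by exists (ternary_sum x 0 + 3 / 2 * 3^-1 ^+ 0) => _ [m _ <-];
  apply: ternary_sum_tail.
Qed.

(** At the first digit where the sequences differ, the digit 1 weighs 3 ^- n
    whereas all later digits together weigh at most half of that; base 3 is
    used because in base 2 the two could be equal. *)
Lemma real_of_bits_lt x y n :
  (forall i, (i < n)%N -> x i = y i) -> x n = false -> y n = true ->
  real_of_bits x < real_of_bits y.
Proof.
move=> Exy xn yn.
have le_x : real_of_bits x <= ternary_sum x n.+1 + 3 / 2 * 3^-1 ^+ n.+1.
  apply: ge_sup; first by exists (ternary_sum x 0), 0%N.
  by move=> _ [m _ <-]; apply: ternary_sum_tail.
have ge_y := ternary_sum_le_real y n.+1.
have Esum : ternary_sum x n = ternary_sum y n.
  by apply: eq_bigr => i _; rewrite Exy.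
move: le_x ge_y; rewrite !ternary_sumS xn yn Esum exprS.
by have := pow3_gt0 n; rewrite /=; lra.
Qed.

Lemma real_of_bits_inj : injective real_of_bits.
Proof.
move=> x y Exy; apply/funext => k; apply/eqP/negPn/negP => neq_k.
have ex_neq : exists k, x k != y k by exists k.
case: (ex_minnP ex_neq) => n neq_n min_n.
have eq_lt i : (i < n)%N -> x i = y i.
  by move=> lt_in; apply/eqP/negPn/negP => /min_n; rewrite leqNgt lt_in.
case Exn: (x n) neq_n; case Eyn: (y n) => // _.
  have := real_of_bits_lt y x n (fun i lt_in => esym (eq_lt i lt_in)) Eyn Exn.
  by rewrite Exy ltxx.
by have := real_of_bits_lt x y n eq_lt Exn Eyn; rewrite Exy ltxx.
Qed.

Lemma bits_card_real : [set: nat -> bool] #= [set: R].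
Proof.
apply: Cantor_Bernstein.
  apply: (card_le_of_inj _ _ real_of_bits) => // x y _ _.
  exact: real_of_bits_inj.
by apply: (card_le_of_inj _ _ cut_bits) => // r s _ _; apply: cut_bits_inj.
Qed.

End BitsAndReals.

(** * A satisfactory coloring for each binary sequence *)

Local Open Scope nat_scope.

Definition level (m : nat) : nat := logn 3 m + logn 5 m + logn 7 m.

(** The residue modulo 4 is the index in the list of the level; the weights
    2 and 3 of the primes 5 and 7 make 3a, 6a, 5a, 7a take four consecutive
    residues. *)
Definition position (m : nat) : nat :=
  logn 2 m + 2 * logn 5 m + 3 * logn 7 m.

Definition level_colors (odd_level swap : bool) : seq nat :=
  if odd_level then (if swap then [:: 6; 3; 5; 7] else [:: 3; 6; 5; 7])
  else (if swap then [:: 2; 1; 4; 8] else [:: 1; 2; 4; 8]).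

(** Levels 0 and 1 keep the order that gives the numbers 1, ..., 8 their
    prescribed colors. *)
Definition swap_level (x : nat -> bool) (k : nat) : bool :=
  if k is n.+2 then x n else false.

Definition bits_color (x : nat -> bool) (m : nat) : nat :=
  nth 0 (level_colors (odd (level m)) (swap_level x (level m)))
        (position m %% 4).

Lemma bits_color_bounds x m : 0 < bits_color x m <= 8.
Proof.
rewrite /bits_color; have := ltn_pmod (position m) (isT : 0 < 4).
by case: (odd _) (swap_level _ _) (_ %% 4) => [] [] [|[|[|[|]]]].
Qed.

Definition coloring_of_bits (x : nat -> bool) : K8 -> color8 :=
  fun a => exist _ (bits_color x (val a)) (bits_color_bounds x (val a)).

Lemma levelM m n : 0 < m -> 0 < n -> level (m * n) = level m + level n.
Proof. by move=> m_gt0 n_gt0; rewrite /level !lognM //; lia. Qed.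

Lemma positionM m n :
  0 < m -> 0 < n -> position (m * n) = position m + position n.
Proof. by move=> m_gt0 n_gt0; rewrite /position !lognM //; lia. Qed.

(** The colors of a, 2a, 4a, 8a are a rotation of the list of the level of a,
    and those of 3a, 6a, 5a, 7a a rotation of the list of the next level; one
    list consists of 1, 2, 4, 8 and the other of 3, 5, 6, 7. *)
Lemma uniq_bits_color x a :
  0 < a -> uniq [seq bits_color x (i * a) | i <- iota 1 8].
Proof.
move=> a_gt0; rewrite /bits_color /= !levelM ?positionM //.
have -> : (level 1 = 0) * (level 2 = 0) * (level 3 = 1) * (level 4 = 0) *
  (level 5 = 1) * (level 6 = 1) * (level 7 = 1) * (level 8 = 0) by [].
have -> : (position 1 = 0) * (position 2 = 1) * (position 3 = 0) *
  (position 4 = 2) * (position 5 = 2) * (position 6 = 1) * (position 7 = 3) *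
  (position 8 = 3) by [].
rewrite !add0n !add1n -(modnDmr 1) -(modnDmr 2) -(modnDmr 3) [odd _.+1]/=.
(* Only the residue of the position, the parity of the level and the two swap
   bits are left, so finitely many cases remain. *)
have := ltn_pmod (position a) (isT : 0 < 4).
move: (position a %% 4) => p; move: (odd (level a)) => o.
move: (swap_level x _) (swap_level x _) => s t.
by case: p => [|[|[|[|p]]]] // _; case: o; case: s; case: t.
Qed.

Lemma coloring_of_bits_sat x : C_K8 (coloring_of_bits x).
Proof.
split=> [[i lt_i]|a i j /(congr1 val) /= Eij]; apply: val_inj => /=.
  by case: i lt_i => [|[|[|[|[|[|[|[|[|i]]]]]]]]].
have a_gt0 : 0 < val a by case: a {Eij} => m /= /andP[].
have color_nth (k : color8) : bits_color x (val k * val a) =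
    nth 0 [seq bits_color x (l * val a) | l <- iota 1 8] (val k).-1.
  by case: k => [] [|[|[|[|[|[|[|[|[|k]]]]]]]]].
have lt_size (k : color8) : (val k).-1 < 8 by case: k => [] [|k].
move: Eij; rewrite !color_nth => /eqP.
rewrite nth_uniq ?size_map ?size_iota ?lt_size ?uniq_bits_color // => /eqP.
by case: i j => [] [|i] // ? [[|j] //= ?] ->.
Qed.

Lemma coloring_of_bits_inj : injective coloring_of_bits.
Proof.
move=> x y Exy; apply/funext => n.
have K8_pow3 : primes8.-nat (3 ^ n.+2) by rewrite pnatX.
(* The number 3 ^ (n + 2) has level n + 2 and position 0. *)
have level3 : level (3 ^ n.+2) = n.+2.
  by rewrite /level !lognX /= !muln0 muln1 !addn0.
have position3 : position (3 ^ n.+2) = 0.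
  by rewrite /position !lognX /= !muln0.
have := congr1 (fun c : K8 -> color8 =>
  val (c (exist (fun m => primes8.-nat m) _ K8_pow3))) Exy.
rewrite /= /bits_color level3 position3 /=.
by case: (odd n) (x n) (y n) => [] [] [].
Qed.

(** * Colorings as binary sequences *)

(** The graph of a coloring is a set of pairs of natural numbers, and this is
    its indicator function along an enumeration of these pairs. *)
Definition graph_bits (c : K8 -> color8) (n : nat) : bool :=
  if unpickle n is Some (m, i)
  then `[< exists a, val a = m /\ val (c a) = i >] else false.

Lemma graph_bits_inj : injective graph_bits.
Proof.
move=> c d Ecd; apply/funext => a; apply/val_inj.
have := congr1 (fun b => b (pickle (val a, val (c a)))) Ecd.
rewrite /graph_bits pickleK => /esym.
have -> : `[< exists b, val b = val a /\ val (c b) = val (c a) >].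
  by apply/asboolP; exists a.
by move=> /asboolP[b [/val_inj -> ->]].
Qed.

Lemma C_K8_card_bits : C_K8 #= [set: nat -> bool].
Proof.
apply: Cantor_Bernstein.
  apply: (card_le_of_inj _ _ graph_bits) => // c d _ _.
  exact: graph_bits_inj.
apply: (card_le_of_inj _ _ coloring_of_bits) => [x y _ _|x _].
  exact: coloring_of_bits_inj.
exact: coloring_of_bits_sat.
Qed.

Theorem theorem5p8 (R : realType) : C_K8 #= [set: R].
Proof. exact: card_eq_trans C_K8_card_bits (bits_card_real R). Qed.
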